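(* Let $n\ge 1$ and $\lambda>0$, and let $\sigma:\mathbb{R}^n\to\mathbb{R}^n$, $\sigma_i(z) = \frac{\exp(\lambda z_i)}{\sum_{j=1}^n\exp(\lambda z_j)}$ for $1\le i\le n$, be the softmax function. Then $\sigma$ is monotone, that is, $$(\sigma(z)-\sigma(z'))^\top(z-z')\ge 0\quad\text{for all } z,z'\in\mathbb{R}^n,$$ and $\sigma$ is not strictly monotone on $\mathbb{R}^n$.
   Context: A map $F:\mathbb{R}^n\to\mathbb{R}^n$ is strictly monotone on $\mathbb{R}^n$ if $(F(z)-F(z'))^\top(z-z')>0$ for all $z,z'\in\mathbb{R}^n$ with $z\ne z'$. *)

(* Defs.v *)
From HB Require Import structures.
From mathcomp Require Import all_boot all_order all_algebra.
From mathcomp Require Import reals sequences exp.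

Set Implicit Arguments.
Unset Strict Implicit.
Unset Printing Implicit Defensive.

Import Order.TTheory GRing.Theory Num.Theory.
Local Open Scope ring_scope.

Definition dotv (R : realType) (n : nat) (u v : 'cV[R]_n) : R :=
  (u^T *m v) 0 0.

Definition monotone_map (R : realType) (n : nat) (F : 'cV[R]_n -> 'cV[R]_n) :
    Prop :=
  forall z z' : 'cV[R]_n, 0 <= dotv (F z - F z') (z - z').

Definition strictly_monotone_map (R : realType) (n : nat)
    (F : 'cV[R]_n -> 'cV[R]_n) : Prop :=
  forall z z' : 'cV[R]_n, z <> z' -> 0 < dotv (F z - F z') (z - z').

Definition softmax (R : realType) (n : nat) (lambda : R) (z : 'cV[R]_n) :
    'cV[R]_n :=
  \col_(i < n) (expR (lambda * z i 0) / \sum_(j < n) expR (lambda * z j 0)).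

(* Main.v *)
Require Import Defs.
From HB Require Import structures.
From mathcomp Require Import all_boot all_order all_algebra.
From mathcomp Require Import reals sequences exp.
From mathcomp Require Import ring.

Set Implicit Arguments.
Unset Strict Implicit.
Unset Printing Implicit Defensive.

Import Order.TTheory GRing.Theory Num.Theory.
Local Open Scope ring_scope.

(** Write [p] and [q] for the softmax values at [z] and [z'], and [d = z - z'].
    Since [p] and [q] both sum to 1, antisymmetrizing the double sum of
    [p i * q j * (d i - d j)] gives (lemma [sum_sub_mul_antisym])
      [2 (p - q)^T d = \sum_(i, j) (p i q j - p j q i) (d i - d j)].
    Up to a positive normalization common to both terms, [p i q j] and
    [p j q i] are the exponentials of [lambda (z i + z' j)] and
    [lambda (z j + z' i)], whose exponents differ by [lambda (d i - d j)].
    As [expR] is increasing, every term of the double sum is a product of two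
    factors of the same sign, which proves monotonicity.

    Strictness fails because softmax does not change when the same constant is
    added to all coordinates ([softmax_shift]): it takes equal values at the
    distinct points [0] and [(1, ..., 1)]. *)

Lemma dotvE (R : realType) (n : nat) (u v : 'cV[R]_n) :
  dotv u v = \sum_(i < n) u i 0 * v i 0.
Proof. by rewrite /dotv mxE; apply: eq_bigr => i _; rewrite mxE. Qed.

(** The right-hand side is a sum of products that can be signed one by one when
    [d] is ordered like the ratios [p i / q i]: this is Chebyshev's sum
    inequality written as an identity. *)
Lemma sum_sub_mul_antisym (R : comPzRingType) (n : nat) (p q d : 'I_n -> R) :
  \sum_i p i = 1 -> \sum_i q i = 1 ->
  (\sum_i (p i - q i) * d i) *+ 2 =
  \sum_i \sum_j (p i * q j - p j * q i) * (d i - d j).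
Proof.
move=> p1 q1.
have half : \sum_i (p i - q i) * d i =
            \sum_i \sum_j (p i * q j - p j * q i) * d i.
  apply: eq_bigr => i _.
  by rewrite -mulr_suml sumrB -mulr_sumr -mulr_suml p1 q1 mulr1 mul1r.
(* exchanging the two indices flips the sign of the antisymmetric factor *)
have swap : \sum_i (p i - q i) * d i =
            - \sum_i \sum_j (p i * q j - p j * q i) * d j.
  rewrite half exchange_big /= -sumrN; apply: eq_bigr => i _.
  by rewrite -sumrN; apply: eq_bigr => j _; ring.
rewrite mulr2n {1}half swap -sumrB; apply: eq_bigr => i _.
by rewrite -sumrB; apply: eq_bigr => j _; rewrite mulrBr.
Qed.

Lemma sum_expR_gt0 (R : realType) (n : nat) (f : 'I_n -> R) :
  (0 < n)%N -> 0 < \sum_i expR (f i).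
Proof.
move=> n_gt0; rewrite (bigD1 (Ordinal n_gt0)) //=.
by rewrite ltr_wpDr ?expR_gt0// sumr_ge0// => i _; exact: expR_ge0.
Qed.

Lemma sum_softmax (R : realType) (n : nat) (lambda : R) (z : 'cV[R]_n) :
  (0 < n)%N -> \sum_i softmax lambda z i 0 = 1.
Proof.
move=> n_gt0; under eq_bigr do rewrite mxE.
by rewrite -mulr_suml divff// gt_eqF// sum_expR_gt0.
Qed.

Lemma subr_expR_mul_ge0 (R : realType) (x y : R) :
  0 <= (expR x - expR y) * (x - y).
Proof.
have [le_yx|/ltW le_xy] := leP y x.
  by rewrite mulr_ge0// subr_ge0// ler_expR.
by rewrite mulr_le0// subr_le0// ler_expR.
Qed.

(** The cross products of two softmax values share the denominator, so their
    difference has the sign of the difference of the exponents. *)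
Lemma softmax_cross_ge0 (R : realType) (n : nat) (lambda : R)
    (z z' : 'cV[R]_n) (i j : 'I_n) : 0 < lambda ->
  0 <= (softmax lambda z i 0 * softmax lambda z' j 0 -
        softmax lambda z j 0 * softmax lambda z' i 0) *
       ((z i 0 - z' i 0) - (z j 0 - z' j 0)).
Proof.
move=> lambda_gt0; rewrite !mxE.
set A := \sum_(k < n) _; set B := \sum_(k < n) _.
have A_ge0 : 0 <= A by apply: sumr_ge0 => k _; exact: expR_ge0.
have B_ge0 : 0 <= B by apply: sumr_ge0 => k _; exact: expR_ge0.
rewrite !(mulrACA _ A^-1) -!expRD -mulrBl -(pmulr_rge0 _ lambda_gt0).
set x := lambda * _ + _; set y := lambda * z j 0 + _.
rewrite [leRHS](_ : _ = (expR x - expR y) * (x - y) * (A^-1 * B^-1)).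
  by rewrite mulr_ge0 ?subr_expR_mul_ge0// mulr_ge0// invr_ge0.
by rewrite /x /y; ring.
Qed.

Lemma softmax_monotone (R : realType) (n : nat) (lambda : R) :
  (0 < n)%N -> 0 < lambda -> monotone_map (@softmax R n lambda).
Proof.
move=> n_gt0 lambda_gt0 z z'.
have -> : dotv (softmax lambda z - softmax lambda z') (z - z') =
    \sum_i (softmax lambda z i 0 - softmax lambda z' i 0) * (z i 0 - z' i 0).
  by rewrite dotvE; apply: eq_bigr => i _; rewrite !mxE.
rewrite -(pmulrn_lge0 _ (isT : (0 < 2)%N)) sum_sub_mul_antisym ?sum_softmax//.
apply: sumr_ge0 => i _; apply: sumr_ge0 => j _.
exact: softmax_cross_ge0.
Qed.

Lemma softmax_shift (R : realType) (n : nat) (lambda c : R) (z : 'cV[R]_n) :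
  softmax lambda (z + const_mx c) = softmax lambda z.
Proof.
apply/colP => i; rewrite !mxE.
under eq_bigr do rewrite !mxE mulrDr expRD.
by rewrite -mulr_suml mulrDr expRD -mulf_div divff ?mulr1// gt_eqF ?expR_gt0.
Qed.

Lemma softmax_not_strictly_monotone (R : realType) (n : nat) (lambda : R) :
  (0 < n)%N -> ~ strictly_monotone_map (@softmax R n lambda).
Proof.
move=> n_gt0 strict.
have neq : 0 + const_mx 1 <> 0 :> 'cV[R]_n.
  move=> /colP/(_ (Ordinal n_gt0))/eqP.
  by rewrite !mxE add0r oner_eq0.
by have := strict _ _ neq; rewrite softmax_shift subrr /dotv trmx0 mul0mx mxE ltxx.
Qed.

Theorem proposition3 (R : realType) (n : nat) (lambda : R)
    (n_ge1 : (1 <= n)%N) (lambda_gt0 : 0 < lambda) :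
  monotone_map (@softmax R n lambda) /\
  ~ strictly_monotone_map (@softmax R n lambda).
Proof.
split; first exact: softmax_monotone.
exact: softmax_not_strictly_monotone.
Qed.
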